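(* Let $G$ be a finite group generated by a conjugacy class $\mathcal C$ of involutions. Then $G$ is nilpotent if and only if there exists $n\in\mathbb N$ such that, for every $a,b\in\mathcal C$, the order $|ab\,Z(G)|$ of the element $ab\,Z(G)$ of $G/Z(G)$ divides $2^n$.
   Context: An involution is an element of order $2$; $Z(G)$ denotes the center of $G$. $\mathbb N$ includes $0$. *)

(* Defs.v *)
From mathcomp Require Import all_boot all_order all_algebra all_fingroup all_solvable.
Set Implicit Arguments.
Unset Strict Implicit.
Unset Printing Implicit Defensive.

(* Main.v *)
Require Import Defs.
From mathcomp Require Import all_boot all_order all_algebra all_fingroup all_solvable.
Set Implicit Arguments.
Unset Strict Implicit.
Unset Printing Implicit Defensive.
Local Open Scope group_scope.

(** The prime 2 is special because two elements [u], [v] with [u^2 = v^2 = 1]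
    generate a dihedral group, in which everything is controlled by the single
    product [u * v]: the group is a 2-group as soon as [u * v] is a 2-element.

    If [G] is nilpotent, it is the direct product of its Sylow subgroups, so
    the 2-elements of [C] all lie in ['O_2(G)]; as they generate [G], the whole
    group is a 2-group and [2 ^ n] can be taken to be its order.

    Conversely, write [Q = G / 'Z(G)]. The hypothesis says that any two members
    of the image of [C] have a 2-element as product, hence generate a 2-group.
    As [C] is a conjugacy class, this applies to an element [x] of the image and
    any of its [Q]-conjugates, which is what the Baer-Suzuki theorem asks for to
    put [x] in ['O_2(Q)]. So [Q] is a 2-group; it is nilpotent, and then so is
    its central extension [G]. *)

(** The generators lie in ['O_p(G)]: in a nilpotent group it contains every
    [p]-element of [G], being a Hall subgroup. *)
Lemma nilpotent_gen_p_elt_pgroup (p : nat) (gT : finGroupType) (G : {group gT})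
    (A : {set gT}) :
  <<A>> = G -> nilpotent G -> {in A, forall x, p.-elt x} -> p.-group G.
Proof.
move=> defG nilG pA; apply: pgroupS (pcore_pgroup p G).
rewrite -{1}defG gen_subG; apply/subsetP=> x Ax.
rewrite (mem_normal_Hall (nilpotent_pcore_Hall p nilG) (pcore_normal p G)).
  exact: pA.
by rewrite -defG mem_gen.
Qed.

(** The relation [x ^ 2 = y ^ 2 = 1] makes [x] invert [x * y] under
    conjugation, so [<<[set x; y]>>] is the product of the 2-group [<[x]>]
    and the 2-group [<[x * y]>], which [<[x]>] normalises. *)
Lemma pgroup2_gen_pair (gT : finGroupType) (x y : gT) :
  x ^+ 2 = 1 -> y ^+ 2 = 1 -> 2.-elt (x * y) -> 2.-group <<[set x; y]>>.
Proof.
move=> x2 y2 pxy.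
have xV: x^-1 = x by apply/eqP; rewrite eq_invg_mul -x2 expgS expg1.
have yV: y^-1 = y by apply/eqP; rewrite eq_invg_mul -y2 expgS expg1.
have nxy: <[x]> \subset 'N(<[x * y]>).
  rewrite cycle_subG inE -cycleJ cycle_subG.
  suff ->: (x * y) ^ x = (x * y)^-1 by rewrite groupV cycle_id.
  by rewrite conjgE mulgA mulKg invMg xV yV.
have: 2.-group (<[x]> <*> <[x * y]>).
  rewrite norm_joinEl // pgroupM [2.-group <[x * y]>]pxy andbT /pgroup -orderE.
  by apply: (@pnat_dvd _ 2); rewrite ?pnat_id // order_dvdn x2.
apply: pgroupS; rewrite gen_subG subUset !sub1set.
have Jx: x \in <[x]> <*> <[x * y]> by rewrite mem_gen // inE cycle_id.
have Jxy: x * y \in <[x]> <*> <[x * y]> by rewrite mem_gen // inE cycle_id orbT.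
by rewrite Jx -(groupMl y Jx).
Qed.

(** The criterion behind the converse direction; [A] is only asked to be stable
    under conjugation, so that it can be applied to the image of a class in a
    quotient. *)
Lemma pgroup2_gen_involutions (gT : finGroupType) (G : {group gT})
    (A : {set gT}) :
    <<A>> = G -> G \subset 'N(A) -> {in A, forall x, x ^+ 2 = 1} ->
  {in A &, forall x y, 2.-elt (x * y)} -> 2.-group G.
Proof.
move=> defG nAG A2 pA; apply: pgroupS (pcore_pgroup 2 G).
rewrite -{1}defG gen_subG; apply/subsetP=> x Ax.
apply: Baer_Suzuki => [|y Gy]; first by rewrite -defG mem_gen.
have Axy: x ^ y \in A by rewrite memJ_norm // (subsetP nAG).
by apply: pgroup2_gen_pair; [apply: A2 | apply: A2 | apply: pA].
Qed.

Theorem corollary3p15 (gT : finGroupType) (G : {group gT}) (C : {set gT})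
    (C_class : C \in classes G)
    (C_involutions : forall x : gT, x \in C -> #[x] = 2%N)
    (G_gen : <<C>> = G) :
  nilpotent G <->
  exists n : nat, forall a b : gT, a \in C -> b \in C ->
    (#[coset 'Z(G) (a * b)] %| 2 ^ n)%N.
Proof.
have sCG: C \subset G by rewrite -G_gen subset_gen.
have nZG: G \subset 'N('Z(G)) := normal_norm (center_normal G).
have nZC: C \subset 'N('Z(G)) := subset_trans sCG nZG.
split=> [nilG | [n pCC]].
  have pG: 2.-group G.
    apply: nilpotent_gen_p_elt_pgroup G_gen nilG _ => x Cx.
    by rewrite /p_elt C_involutions.
  have [n oG] := p_natP pG; exists n => a b Ca Cb; rewrite -oG.
  apply: dvdn_trans (dvdn_quotient G 'Z(G)).
  by rewrite order_dvdG // mem_quotient // groupM // (subsetP sCG).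
rewrite -quotient_center_nil; apply: (@pgroup_nil _ 2).
apply: (@pgroup2_gen_involutions _ (G / 'Z(G))%G (C / 'Z(G))).
- by rewrite /= -quotient_gen // G_gen.
- have nCG: G \subset 'N(C) by have /imsetP[x _ ->] := C_class; apply: class_norm.
  exact: quotient_norms.
- move=> _ /morphimP[x Nx Cx ->].
  by rewrite -morphX // -(C_involutions x Cx) expg_order morph1.
move=> _ _ /morphimP[a Na Ca ->] /morphimP[b Nb Cb ->].
by rewrite -morphM // /p_elt (pnat_dvd (pCC a b Ca Cb)) // pnatX pnat_id.
Qed.
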